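(* Let $A\in\mathbb{R}^{n\times n}$ be a nonsingular symmetric indefinite matrix, let $T\in\mathbb{R}^{n\times n}$ be symmetric positive definite (SPD), and let $f\in\mathbb{R}^n$. Assume that the spectrum of $TA$ is enclosed within a pair of intervals $[a,b]\cup[c,d]$ of equal length ($b-a=d-c$), where $a\le b<0<c\le d$. Fix $\beta\in(b,c)$. Given any initial guess $x^{(0)}\in\mathbb{R}^n$, consider the iteration $$x^{(i+1)}=x^{(i)}+\alpha^{(i)}l^{(i)},\qquad \alpha^{(i)}=\frac{(w^{(i)},Al^{(i)})}{(Al^{(i)},TAl^{(i)})},\qquad i=0,1,\ldots,$$ where $r^{(i)}=f-Ax^{(i)}$, $w^{(i)}=Tr^{(i)}$, $s^{(i)}=TAw^{(i)}$ and $l^{(i)}=s^{(i)}-\beta w^{(i)}$ (the iteration stops with the exact solution if $r^{(i)}=0$). Then the method converges to the solution $A^{-1}f$ of $Ax=f$, and for every $i$ with $r^{(i)}\neq0$ $$\frac{\|r^{(i+1)}\|_T}{\|r^{(i)}\|_T}\le\rho_{opt}(\beta),\qquad \rho_{opt}(\beta)=\frac{\tilde\kappa(\beta)-1}{\tilde\kappa(\beta)+1},\qquad \tilde\kappa(\beta)=\frac{\max_{\lambda\in\{a,d\}}(\lambda^2-\beta\lambda)}{\min_{\lambda\in\{b,c\}}(\lambda^2-\beta\lambda)} .$$ Moreover, if $\beta=\beta_{opt}=c-|b|$, then for every $i$ with $r^{(i)}\ne0$ $$\frac{\|r^{(i+1)}\|_T}{\|r^{(i)}\|_T}\le\frac{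|ad|-|bc|}{|ad|+|bc|}.$$
   Context: $(\cdot,\cdot)$ is the Euclidean inner product on $\mathbb{R}^n$, and for the SPD matrix $T$, $\|v\|_T=(v,Tv)^{1/2}$. A symmetric matrix is indefinite if it has both positive and negative eigenvalues. All eigenvalues of $TA$ are real. *)

(* Defs.v *)
From mathcomp Require Export all_boot all_order all_algebra.
From mathcomp Require Export all_classical all_reals all_analysis.

Set Implicit Arguments.
Unset Strict Implicit.
Unset Printing Implicit Defensive.

Import Order.TTheory GRing.Theory Num.Theory.
Import numFieldNormedType.Exports.

Local Open Scope ring_scope.

Definition inner (R : realType) (n : nat) (u v : 'cV[R]_n) : R :=
  \sum_(i < n) u i 0 * v i 0.

Definition normT (R : realType) (n : nat) (T : 'M[R]_n) (v : 'cV[R]_n) : R :=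
  Num.sqrt (inner v (T *m v)).

Definition spd (R : realType) (n : nat) (T : 'M[R]_n) : Prop :=
  T \is symmetricmx /\
  forall v : 'cV[R]_n, v != 0 -> 0 < inner v (T *m v).

Definition indefinite (R : realType) (n : nat) (A : 'M[R]_n) : Prop :=
  (exists2 lambda : R, eigenvalue A lambda & 0 < lambda) /\
  (exists2 lambda : R, eigenvalue A lambda & lambda < 0).

(* Quantifying over real eigenvalues only loses nothing for M = TA with T SPD
   and A symmetric, whose spectrum is real.  [eigenvalue] is about row
   eigenvectors; this does not affect the set of eigenvalues. *)
Definition spectrum_in (R : realType) (n : nat) (M : 'M[R]_n)
    (a b c d : R) : Prop :=
  forall lambda : R, eigenvalue M lambda ->
    lambda \in `[a, b] \/ lambda \in `[c, d].

Section Iteration.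
Variables (R : realType) (n : nat) (A T : 'M[R]_n) (f : 'cV[R]_n) (beta : R).

Definition residual (x : 'cV[R]_n) : 'cV[R]_n := f - A *m x.

Definition precond_residual (x : 'cV[R]_n) : 'cV[R]_n := T *m residual x.

Definition direction (x : 'cV[R]_n) : 'cV[R]_n :=
  let w := precond_residual x in
  let s := T *m A *m w in
  s - beta *: w.

Definition step_length (x : 'cV[R]_n) : R :=
  let w := precond_residual x in
  let l := direction x in
  inner w (A *m l) / inner (A *m l) (T *m (A *m l)).

(* Stopping at a zero residual is rendered by repeating the iterate. *)
Definition step (x : 'cV[R]_n) : 'cV[R]_n :=
  if residual x == 0 then x else x + step_length x *: direction x.

Definition iterate (x0 : 'cV[R]_n) (i : nat) : 'cV[R]_n := iter i step x0.

End Iteration.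

Definition kappa_tilde (R : realType) (a b c d beta : R) : R :=
  let p := fun lambda : R => lambda ^+ 2 - beta * lambda in
  Num.max (p a) (p d) / Num.min (p b) (p c).

Definition rho_opt (R : realType) (a b c d beta : R) : R :=
  (kappa_tilde a b c d beta - 1) / (kappa_tilde a b c d beta + 1).

(* Main.v *)
Require Import Defs.
From mathcomp Require Import ring lra complex.

(** The residuals satisfy r' = r - alpha B r with B = (AT)^2 - beta AT, and
alpha is the step that minimises the T-norm of r - alpha B r.  The method is
therefore steepest descent for B in the geometry of (u, v)_T = (u, Tv).  In
that geometry AT is self-adjoint, with the same eigenvalues lambda as TA, so B
is self-adjoint with eigenvalues p(lambda) = lambda^2 - beta lambda.  Since beta
lies in the gap (b, c), p is positive on [a, b] and [c, d]; being convex with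
its vertex beta / 2 inside (b, c), it ranges there between
m = min (p b) (p c) and M = max (p a) (p d) ([quadratic_bounds]).  Choosing beta
in the gap thus turns an indefinite operator into a positive one.

Because all eigenvalues of B lie in [m, M], the operator (B - m)(B - M) is
negative semidefinite, which reads
|Br|^2 + m M |r|^2 <= (m + M) (r, Br)_T ([kantorovich_form_le0]).  The minimal
value of |r - alpha B r|^2 is |r|^2 - (r, Br)_T^2 / |Br|^2, and by the
arithmetic-geometric mean inequality the previous bound makes it at most
((M - m) / (M + m))^2 |r|^2 ([steepest_step_bound]); this factor is
(kappa - 1) / (kappa + 1) for kappa = M / m.  The contraction factor is below 1,
so the residuals tend to 0 geometrically and the iterates converge
([cvg_of_normT_residual]).  For beta = b + c the equal lengths of the intervals
give b + c = a + d, so p takes the value - bc at b and c and the value - ad at a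
and d.

The spectral theorem enters only through [spectral_moments], which expresses the
T-products of the vectors (AT)^j v by a positive measure on the spectrum of TA.
It is obtained over the complex numbers: a simultaneous diagonalisation of T and
A ([hermitian_pencil_diag]) has real eigenvalues, and for real vectors only the
squared moduli of their complex coordinates matter. *)

Set Implicit Arguments.
Unset Strict Implicit.
Unset Printing Implicit Defensive.

Import Order.TTheory GRing.Theory Num.Theory.
Import numFieldNormedType.Exports.

Local Open Scope classical_set_scope.
Local Open Scope ring_scope.

(** * Simultaneous diagonalisation of a Hermitian pencil *)

Section HermitianPencil.
Local Open Scope sesquilinear_scope.
Variables (C : numClosedFieldType) (n : nat).
Implicit Types (A T : 'M[C]_n).

Lemma hermsymmx_congr A (Q : 'M[C]_n) :
  A \is hermsymmx -> Q *m A *m Q^t* \is hermsymmx.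
Proof.
move=> /is_hermitianmxP; rewrite expr0 scale1r => eA.
apply/is_hermitianmxP; rewrite expr0 scale1r.
by rewrite !trmx_mul !map_mxM trmxCK mulmxA -eA.
Qed.

Lemma hermsymmx_spectral A : A \is hermsymmx ->
  A = (spectralmx A)^t* *m diag_mx (spectral_diag A) *m spectralmx A.
Proof.
move=> /hermitian_normalmx /orthomx_spectralP.
by rewrite invmx_unitary ?spectral_unitarymx.
Qed.

(** Q is sqrt(D) P for a unitary diagonalisation of T with eigenvector matrix P
and eigenvalues D: positivity makes sqrt(D) real, hence self-adjoint. *)
Lemma posdef_hermitian_factor T : T \is hermsymmx ->
  (forall lambda : C,
     lambda \is Num.real -> eigenvalue T lambda -> 0 < lambda) ->
  exists Q : 'M[C]_n, T = Q^t* *m Q.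
Proof.
move=> Therm Tpos; have eT := hermsymmx_spectral Therm.
set P := spectralmx T in eT; set D := spectral_diag T in eT.
have PP : P *m P^t* = 1%:M by apply/unitarymxP/spectral_unitarymx.
have D_gt0 i : 0 < D 0 i.
  apply: Tpos; first exact/mxOverP/hermitian_spectral_diag_real.
  apply/eigenvalueP; exists (row i P).
    rewrite [in LHS]eT -row_mul !mulmxA PP mul1mx mul_diag_mx.
    by apply/rowP => j; rewrite !mxE.
  apply: contraTneq (oner_neq0 C) => Pi0; apply/negPn/eqP.
  have /matrixP/(_ i i) := PP; rewrite !mxE eqxx mulr1n => <-.
  rewrite big1 // => j _; have /matrixP/(_ 0 j) := Pi0; rewrite !mxE => ->.
  by rewrite mul0r.
exists (diag_mx (map_mx sqrtC D) *m P).
rewrite trmx_mul map_mxM tr_diag_mx map_diag_mx mulmxA -(mulmxA (P^t*)).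
rewrite mulmx_diag [LHS]eT; congr (_ *m diag_mx _ *m _).
apply/rowP => i; rewrite !mxE -[LHS]sqrtCK expr2; congr (_ * _).
by apply/esym/conj_Creal; rewrite ger0_real // sqrtC_ge0 ltW.
Qed.

(** With T = Q^* Q, the matrix AT is conjugated by Q into Q A Q^*, which is
Hermitian, so a unitary U diagonalises it; W = U Q then diagonalises AT and
still factors T, because U is unitary. *)
Lemma hermitian_pencil_diag A T : A \is hermsymmx -> T \is hermsymmx ->
  (forall lambda : C,
     lambda \is Num.real -> eigenvalue T lambda -> 0 < lambda) ->
  exists2 W : 'M[C]_n, T = W^t* *m W &
    exists2 l : 'rV[C]_n, l \is a realmx & W *m (A *m T) = diag_mx l *m W.
Proof.
move=> Aherm Therm /(posdef_hermitian_factor Therm) [Q eT].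
have Hherm := hermsymmx_congr Q Aherm.
set H := Q *m A *m Q^t* in Hherm; pose U := spectralmx H.
have UU : U *m U^t* = 1%:M by apply/unitarymxP/spectral_unitarymx.
have UU' : U^t* *m U = 1%:M by apply/mulmx1C.
exists (U *m Q).
  by rewrite trmx_mul map_mxM mulmxA -[_ *m U]mulmxA UU' mulmx1.
exists (spectral_diag H); first exact: hermitian_spectral_diag_real.
rewrite eT -!mulmxA; transitivity (U *m (H *m Q)).
  by rewrite /H !mulmxA.
by rewrite {1}(hermsymmx_spectral Hherm) -/U !mulmxA UU mul1mx.
Qed.

End HermitianPencil.

(** * The inner product of a symmetric positive definite matrix *)

Section WeightedInnerProduct.
Variables (R : realType) (n : nat).
Implicit Types (A T : 'M[R]_n) (u v w : 'cV[R]_n).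

Lemma innerE u v : inner u v = (u^T *m v) 0 0.
Proof. by rewrite mxE; apply: eq_bigr => i _; rewrite mxE. Qed.

Lemma symmetricmx_tr A : A \is symmetricmx -> A^T = A.
Proof.
move=> /is_hermitianmxP; rewrite expr0 scale1r => {2}->.
by apply/matrixP=> i j; rewrite !mxE.
Qed.

Lemma innerC u v : inner u v = inner v u.
Proof. by apply: eq_bigr => i _; rewrite mulrC. Qed.

Lemma innerDl u v w : inner (u + v) w = inner u w + inner v w.
Proof. by rewrite !innerE linearD mulmxDl mxE. Qed.

Lemma innerZl k u v : inner (k *: u) v = k * inner u v.
Proof. by rewrite !innerE linearZ -scalemxAl mxE. Qed.

Lemma inner0l u : inner 0 u = 0.
Proof. by rewrite innerE trmx0 mul0mx mxE. Qed.

Lemma inner_mull (M : 'M[R]_n) u v : inner (M *m u) v = inner u (M^T *m v).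
Proof. by rewrite !innerE trmx_mul mulmxA. Qed.

Lemma innerDr u v w : inner u (v + w) = inner u v + inner u w.
Proof. by rewrite innerC innerDl !(innerC u). Qed.

Lemma innerZr k u v : inner u (k *: v) = k * inner u v.
Proof. by rewrite innerC innerZl (innerC u). Qed.

Lemma spd_eigenvalue_gt0 T lambda : spd T -> eigenvalue T lambda -> 0 < lambda.
Proof.
case=> Tsym Tpos /eigenvalueP [v vT vn0].
have vt0 : v^T != 0 by rewrite -trmx0 (inj_eq trmx_inj).
have := Tpos _ vt0.
rewrite -{1}(symmetricmx_tr Tsym) -trmx_mul vT linearZ innerZr.
suff : 0 <= inner v^T v^T.
  by rewrite le_eqVlt => /orP[/eqP <-|/pmulr_lgt0 ->//]; rewrite mulr0 ltxx.
by apply: sumr_ge0 => i _; rewrite -expr2 sqr_ge0.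
Qed.

Lemma spd_unit T : spd T -> T \in unitmx.
Proof.
case=> Tsym Tpos; rewrite -row_free_unit; apply: inj_row_free => v vT.
apply/eqP/negPn/negP => vn0.
have vt0 : v^T != 0 by rewrite -trmx0 (inj_eq trmx_inj).
have := Tpos _ vt0.
by rewrite -{1}(symmetricmx_tr Tsym) -trmx_mul vT trmx0 innerC inner0l ltxx.
Qed.

Lemma innerTC T u v : spd T -> inner u (T *m v) = inner v (T *m u).
Proof. by case=> Ts _; rewrite innerC inner_mull (symmetricmx_tr Ts). Qed.

Lemma innerT_ge0 T u : spd T -> 0 <= inner u (T *m u).
Proof.
move=> [_ Tpos]; have [->|/Tpos/ltW//] := eqVneq u 0.
by rewrite inner0l.
Qed.

Lemma innerT_sub T (u v : 'cV[R]_n) (t : R) : spd T ->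
  inner (u - t *: v) (T *m (u - t *: v)) =
  inner u (T *m u) - 2 * t * inner u (T *m v) + t ^+ 2 * inner v (T *m v).
Proof.
move=> Ts; rewrite mulmxBr -scalemxAr -!(scaleNr t).
rewrite !(innerDl, innerDr, innerZl, innerZr) (innerTC v u Ts).
by ring.
Qed.

(** The discriminant argument: the square norm of the component of u that is
T-orthogonal to v is nonnegative. *)
Lemma innerT_cauchy_schwarz T (u v : 'cV[R]_n) : spd T ->
  inner u (T *m v) ^+ 2 <= inner u (T *m u) * inner v (T *m v).
Proof.
move=> Ts; have [->|vn0] := eqVneq v 0.
  by rewrite mulmx0 !(innerC _ 0) !inner0l mulr0 expr0n.
have h_gt0 : 0 < inner v (T *m v) by case: Ts => _; apply.
have := innerT_ge0 (u - (inner u (T *m v) / inner v (T *m v)) *: v) Ts.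
rewrite innerT_sub //; set h := inner v _ in h_gt0 *; set g := inner u (T *m v).
set e := inner u _.
have -> : e - 2 * (g / h) * g + (g / h) ^+ 2 * h = (e * h - g ^+ 2) / h.
  by field; rewrite gt_eqF.
by rewrite pmulr_lge0 ?invr_gt0 // subr_ge0.
Qed.

Lemma normT_ge0 T (u : 'cV[R]_n) : 0 <= normT T u.
Proof. exact: sqrtr_ge0. Qed.

Lemma sqr_normT T (u : 'cV[R]_n) : spd T -> normT T u ^+ 2 = inner u (T *m u).
Proof. by move=> Ts; rewrite sqr_sqrtr // innerT_ge0. Qed.

Lemma normT_gt0 T (u : 'cV[R]_n) : spd T -> u != 0 -> 0 < normT T u.
Proof. by case=> _ Tpos /Tpos; rewrite sqrtr_gt0. Qed.

(** Riesz representation: the functional u |-> y u is the T-product with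
T^-1 y^T.  Applied to the rows of A^-1, this turns a bound on the T-norm of the
residual into one on each coordinate of the error. *)
Lemma functional_le_normT T (y : 'rV[R]_n) : spd T ->
  exists2 K : R, 0 <= K & forall u : 'cV[R]_n, `|(y *m u) 0 0| <= K * normT T u.
Proof.
move=> Ts; exists (normT T (invmx T *m y^T)); first exact: normT_ge0.
move=> u; rewrite -ler_sqr ?nnegrE ?mulr_ge0 ?normT_ge0 //.
rewrite exprMn !sqr_normT // real_normK ?num_real //.
have -> : (y *m u) 0 0 = inner (invmx T *m y^T) (T *m u).
  by rewrite innerTC // mulKVmx ?spd_unit // innerC innerE trmxK.
exact: innerT_cauchy_schwarz.
Qed.

(** * Spectral measures of TA *)

Local Notation toC := (map_mx (real_complex R)).
Local Open Scope sesquilinear_scope.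

Lemma realC_conj m p (M : 'M[R]_(m, p)) : (toC M) ^ (@Num.conj R[i]) = toC M.
Proof. by apply/matrixP => i j; rewrite !mxE conj_Creal // complex_real. Qed.

Lemma toC_hermsymmx A : A \is symmetricmx -> toC A \is hermsymmx.
Proof.
move=> As; apply/is_hermitianmxP; rewrite expr0 scale1r.
by rewrite map_trmx symmetricmx_tr // realC_conj.
Qed.

(** The diagonalisation gives eigenvalues of AT.  Row i of W A is a left
eigenvector of TA for the same eigenvalue, nonzero because W A is invertible. *)
Lemma spd_pencil_diag A T : A \in unitmx -> A \is symmetricmx -> spd T ->
  exists W : 'M[R[i]]_n, exists l : 'I_n -> R,
    [/\ toC T = W^t* *m W,
        W *m toC (A *m T) = diag_mx (\row_i (l i)%:C%C) *m W
      & forall i, eigenvalue (T *m A) (l i)].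
Proof.
move=> Au As Ts; have [Tsym _] := Ts.
have [|W eT [l lreal Wl]] :=
  hermitian_pencil_diag (toC_hermsymmx As) (toC_hermsymmx Tsym).
  move=> _ /complex_realP [k ->]; rewrite eigenvalue_map.
  by move=> /(spd_eigenvalue_gt0 Ts); rewrite ltcR.
have el i : l 0 i = (complex.Re (l 0 i))%:C%C.
  apply/esym; apply: RRe_real; exact: (mxOverP lreal).
have Wunit : W \in unitmx.
  have : toC T \in unitmx by rewrite map_unitmx spd_unit.
  by rewrite eT unitmx_mul => /andP[].
exists W, (fun i => complex.Re (l 0 i)); split => //.
  by rewrite map_mxM Wl; congr (diag_mx _ *m _); apply/rowP => i; rewrite !mxE.
move=> i; suff: eigenvalue (toC (T *m A)) (l 0 i).
  by rewrite {1}el eigenvalue_map.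
rewrite map_mxM.
have WAunit : W *m toC A \in unitmx by rewrite unitmx_mul Wunit map_unitmx.
apply/eigenvalueP; exists (row i (W *m toC A)).
  rewrite -row_mul !mulmxA -(mulmxA W) Wl -mulmxA mul_diag_mx.
  by apply/rowP => j; rewrite !mxE.
apply/eqP => W0; move: WAunit; rewrite -row_free_unit => /row_freeP [V].
move=> /(congr1 (row i)); rewrite row_mul W0 mul0mx => /rowP/(_ i).
by rewrite !mxE eqxx => /eqP; rewrite eq_sym oner_eq0.
Qed.

(** In the coordinates W v, the matrix AT acts as the real diagonal l and the
T-product becomes the standard Hermitian one, so the weight of l i is the
squared modulus of coordinate i of W v. *)
Lemma spectral_moments A T : A \in unitmx -> A \is symmetricmx -> spd T ->
  exists2 l : 'I_n -> R, forall i, eigenvalue (T *m A) (l i) &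
    forall v, exists2 omega : 'I_n -> R, forall i, 0 <= omega i &
      forall j k, inner (iter j (mulmx (A *m T)) v)
                        (T *m iter k (mulmx (A *m T)) v)
                  = \sum_i omega i * l i ^+ (j + k).
Proof.
move=> Au As Ts; have [W [l [eT Wl lev]]] := spd_pencil_diag Au As Ts.
exists l => // v.
(* c is a variable, not a local definition, so that mxE leaves it folded. *)
have [c cE] : exists c, c = W *m toC v by exists (W *m toC v).
exists (fun i => complex.Re (`|c i 0| ^+ 2)).
  move=> i; rewrite -ler0c RRe_real; first exact: exprn_ge0.
  by apply: ger0_real; exact: exprn_ge0.
move=> j k; apply: complexI.
have Wit m : W *m toC (iter m (mulmx (A *m T)) v) =
             \col_i ((l i)%:C%C ^+ m * c i 0).
  elim: m => [|m IH].
    by rewrite -cE; apply/colP => i; rewrite [RHS]mxE mul1r.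
  rewrite iterS map_mxM mulmxA Wl -mulmxA IH mul_diag_mx.
  by apply/colP => i; rewrite !mxE exprS mulrA.
transitivity (((W *m toC (iter j (mulmx (A *m T)) v))^t* *m
              (W *m toC (iter k (mulmx (A *m T)) v))) 0 0).
  transitivity (toC ((iter j (mulmx (A *m T)) v)^T *m
                     (T *m iter k (mulmx (A *m T)) v)) 0 0).
    by rewrite innerE [RHS]mxE.
  by rewrite !map_mxM eT trmx_mul map_mxM map_trmx realC_conj !mulmxA.
rewrite !Wit mxE rmorph_sum; apply: eq_bigr => i _; rewrite !mxE.
set z := c i 0.
transitivity (`|z| ^+ 2 * (l i)%:C%C ^+ (j + k)); last first.
  rewrite [RHS]rmorphM [in RHS]rmorphXn; congr (_ * _); apply/esym/RRe_real.
  by apply: ger0_real; exact: exprn_ge0.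
transitivity ((l i)%:C%C ^+ j * z^* * ((l i)%:C%C ^+ k * z)).
  congr (_ * _); rewrite [LHS]rmorphM [in LHS]rmorphXn; congr (_ ^+ _ * _).
  by apply: conj_Creal; rewrite complex_real.
by rewrite normCK exprD; ring.
Qed.

(** With z = B v, the difference of the two sides is the T-product of
(B - m) v and (B - M) v, i.e. the integral of (p - m)(p - M) against the
spectral measure of v, and this integrand is nonpositive on the spectrum. *)
Lemma kantorovich_form_le0 A T (beta m M : R) (v z : 'cV[R]_n) :
  A \in unitmx -> A \is symmetricmx -> spd T ->
  (forall lambda, eigenvalue (T *m A) lambda ->
     m <= lambda ^+ 2 - beta * lambda <= M) ->
  z = A *m (T *m (A *m (T *m v)) - beta *: (T *m v)) ->
  inner z (T *m z) + m * M * inner v (T *m v) <= (m + M) * inner v (T *m z).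
Proof.
move=> Au As Ts bnd ez.
have [l lev mom] := spectral_moments Au As Ts.
have [omega omega_ge0] := mom v.
pose F k := iter k (mulmx (A *m T)) v; rewrite -/F => momE.
have {}momE j k : inner (F j) (T *m F k) = \sum_i omega i * l i ^+ (j + k).
  exact: momE.
have vE : v = F 0 by [].
have zE : z = F 2 - beta *: F 1.
  by rewrite ez /F /= mulmxBr -scalemxAr !mulmxA.
rewrite zE vE mulmxBr -!scalemxAr -!(scaleNr beta) -subr_le0.
rewrite !(innerDl, innerDr, innerZl, innerZr) !momE.
rewrite !mulr_sumr -!big_split /= mulr_sumr -sumrB.
apply: sumr_le0 => i _.
have /andP[mi Mi] := bnd _ (lev i).
pose p := l i ^+ 2 - beta * l i.
rewrite [leLHS](_ : _ = omega i * ((p - m) * (p - M))); last first.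
  by rewrite /p; ring.
by rewrite mulr_ge0_le0 // mulr_ge0_le0 // ?subr_ge0 ?subr_le0.
Qed.

End WeightedInnerProduct.

(** * Contraction of the residual *)

Section Iteration.
Variables (R : realType).

(** The hypothesis gives (m + M) g >= h + m M e >= 2 sqrt(m M e h) by the
arithmetic-geometric mean inequality, hence g^2 / h >= 4 m M e / (m + M)^2. *)
Lemma steepest_step_bound (e g h m M : R) :
  0 < m -> 0 < M -> 0 < e -> 0 < h -> h + m * M * e <= (m + M) * g ->
  e - g ^+ 2 / h <= ((M - m) / (M + m)) ^+ 2 * e.
Proof.
move=> m0 M0 e0 h0 le_g.
have mM0 : 0 < M + m by rewrite addr_gt0.
have amgm : 4 * (m * M * e) * h <= ((m + M) * g) ^+ 2.
  apply: (@le_trans _ _ ((h + m * M * e) ^+ 2)).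
    by rewrite -subr_ge0 (_ : _ - _ = (h - m * M * e) ^+ 2) ?sqr_ge0 //; ring.
  by rewrite ler_sqr ?nnegrE ?(le_trans _ le_g) // ltW // addr_gt0 // !mulr_gt0.
rewrite -subr_ge0.
have -> : ((M - m) / (M + m)) ^+ 2 * e - (e - g ^+ 2 / h) =
          (((m + M) * g) ^+ 2 - 4 * (m * M * e) * h) / ((M + m) ^+ 2 * h).
  by field; rewrite !gt_eqF.
by rewrite divr_ge0 ?subr_ge0 // mulr_ge0 ?sqr_ge0 // ltW.
Qed.

Lemma residual_step n (A T : 'M[R]_n) f (beta : R) x : residual A f x != 0 ->
  residual A f (step A T f beta x) =
  residual A f x - step_length A T f beta x *: (A *m direction A T f beta x).
Proof.
move=> /negPf rn0; rewrite /step rn0 /residual mulmxDr -scalemxAr opprD addrA.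
by [].
Qed.

(** The increment of the residual is - alpha z with z = A l = B r, and alpha is
the minimiser of the T-norm, so the new square norm is e - g^2 / h with
e = (r, r)_T, g = (r, z)_T, h = (z, z)_T.  The denominator h vanishes only at a
zero residual: the form inequality forces g > 0. *)
Lemma normT_residual_step n (A T : 'M[R]_n) f (beta m M : R) x :
  A \in unitmx -> A \is symmetricmx -> spd T -> 0 < m -> m <= M ->
  (forall lambda, eigenvalue (T *m A) lambda ->
     m <= lambda ^+ 2 - beta * lambda <= M) ->
  normT T (residual A f (step A T f beta x)) <=
    (M - m) / (M + m) * normT T (residual A f x).
Proof.
move=> Au As Ts m0 mM bnd; have M0 := lt_le_trans m0 mM.
have rho_ge0 : 0 <= (M - m) / (M + m).
  by rewrite divr_ge0 ?subr_ge0 // ltW // addr_gt0.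
have [r0|rn0] := eqVneq (residual A f x) 0.
  by rewrite /step r0 eqxx r0 /normT inner0l sqrtr0 mulr0.
rewrite residual_step // /step_length /precond_residual.
set r := residual A f x in rn0 *.
set z := A *m direction A T f beta x.
have ez : z = A *m (T *m (A *m (T *m r)) - beta *: (T *m r)).
  by rewrite /z /direction /precond_residual -/r !mulmxA.
have kant := kantorovich_form_le0 Au As Ts bnd ez.
have e_gt0 : 0 < inner r (T *m r) by case: Ts => _; apply.
have zn0 : z != 0.
  apply: contraTneq kant => ->; rewrite mulmx0 (innerC r 0) !inner0l mulr0.
  by rewrite add0r -ltNge !mulr_gt0.
have h_gt0 : 0 < inner z (T *m z) by case: Ts => _; apply.
have -> : inner (T *m r) z = inner r (T *m z) by rewrite innerC innerTC.
rewrite -ler_sqr ?nnegrE ?(mulr_ge0 rho_ge0) ?normT_ge0 //.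
rewrite exprMn !sqr_normT // innerT_sub //.
apply: le_trans (steepest_step_bound m0 M0 e_gt0 h_gt0 kant).
rewrite le_eqVlt; apply/orP; left; apply/eqP.
by field; rewrite gt_eqF.
Qed.

(** * The quadratic on the two intervals *)

(** The vertex beta / 2 lies between b and c, since b < beta and b < 0 (and
likewise for c).  So p decreases on [a, b] and increases on [c, d]. *)
Lemma quadratic_bounds (a b c d beta lambda : R) :
  a <= b -> b < 0 -> 0 < c -> c <= d -> b < beta < c ->
  lambda \in `[a, b] \/ lambda \in `[c, d] ->
  Num.min (b ^+ 2 - beta * b) (c ^+ 2 - beta * c) <= lambda ^+ 2 - beta * lambda
    <= Num.max (a ^+ 2 - beta * a) (d ^+ 2 - beta * d).
Proof.
move=> ab b0 c0 cd /andP[bbeta betac] lin; pose p x := x ^+ 2 - beta * x.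
rewrite -/(p a) -/(p b) -/(p c) -/(p d) -/(p lambda).
rewrite ge_min le_max.
case: lin; rewrite in_itv /= => /andP[l1 l2].
  have -> : p b <= p lambda by rewrite /p; nra.
  by have -> : p lambda <= p a by rewrite /p; nra.
have -> : p c <= p lambda by rewrite /p; nra.
have -> : p lambda <= p d by rewrite /p; nra.
by rewrite !orbT.
Qed.

Lemma quadratic_min_gt0 (b c beta : R) :
  b < 0 -> 0 < c -> b < beta < c ->
  0 < Num.min (b ^+ 2 - beta * b) (c ^+ 2 - beta * c).
Proof.
by move=> b0 c0 /andP[bb bc]; rewrite lt_min; apply/andP; split; nra.
Qed.

Lemma quadratic_min_le_max (a b c d beta : R) :
  a <= b -> b < 0 -> b < beta ->
  Num.min (b ^+ 2 - beta * b) (c ^+ 2 - beta * c) <=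
  Num.max (a ^+ 2 - beta * a) (d ^+ 2 - beta * d).
Proof.
move=> ab b0 bb; rewrite ge_min le_max.
by rewrite (_ : b ^+ 2 - _ <= a ^+ 2 - _) //; nra.
Qed.

Lemma rho_optE (a b c d beta m M : R) :
  Num.min (b ^+ 2 - beta * b) (c ^+ 2 - beta * c) = m ->
  Num.max (a ^+ 2 - beta * a) (d ^+ 2 - beta * d) = M ->
  0 < m -> m <= M -> rho_opt a b c d beta = (M - m) / (M + m).
Proof.
move=> mE ME m0 mM; rewrite /rho_opt /kappa_tilde mE ME.
by field; rewrite ?gt_eqF //= addr_gt0 // (lt_le_trans m0).
Qed.

(** Here beta = b + c = a + d, so p x = x (x - beta) equals - bc at b and c,
and - ad at a and d. *)
Lemma rho_opt_center (a b c d : R) :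
  b - a = d - c -> a <= b -> b < 0 -> 0 < c -> c <= d ->
  rho_opt a b c d (c - `|b|) =
    (`|a * d| - `|b * c|) / (`|a * d| + `|b * c|).
Proof.
move=> eqlen ab b0 c0 cd.
have a0 := le_lt_trans ab b0; have d0 := lt_le_trans c0 cd.
rewrite (ltr0_norm b0) (@ltr0_norm _ (a * d)) ?(@ltr0_norm _ (b * c));
  rewrite ?nmulr_rlt0 //.
have -> : d = b - a + c by rewrite eqlen; ring.
rewrite /rho_opt /kappa_tilde.
have -> : b ^+ 2 - (c - - b) * b = - (b * c) by ring.
have -> : c ^+ 2 - (c - - b) * c = - (b * c) by ring.
have -> : a ^+ 2 - (c - - b) * a = - (a * (b - a + c)) by ring.
have -> : (b - a + c) ^+ 2 - (c - - b) * (b - a + c) = - (a * (b - a + c)).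
  by ring.
have d'_gt0 : 0 < b - a + c by lra.
have ad_gt0 : 0 < - a * (b - a + c) by rewrite mulr_gt0 // oppr_gt0.
have bc_gt0 : 0 < - b * c by rewrite mulr_gt0 // oppr_gt0.
rewrite maxxx minxx; field.
by rewrite (lt_eqF b0) !gt_eqF //=; lra.
Qed.

(** * Convergence of the iterates *)

Lemma cvg_mx_coord m n (F : nat -> 'M[R]_(m, n)) (L : 'M[R]_(m, n)) :
  (forall i j, F k i j @[k --> \oo] --> L i j) -> F k @[k --> \oo] --> L.
Proof.
move=> FL; apply/cvg_ballP => e e0.
have H : \forall k \near \oo, forall i j, ball (L i j) e (F k i j).
  apply: filter_forall => i; apply: filter_forall => j.
  by have /cvg_ballP/(_ e e0) := FL i j.
by apply: filterS H => k Hk; split.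
Qed.

(** The error is A^-1 times the residual, whose T-norm decays geometrically;
each coordinate of the error is a linear functional of the residual. *)
Lemma cvg_of_normT_residual n (A T : 'M[R]_n) (f : 'cV[R]_n)
    (x : nat -> 'cV[R]_n) (rho : R) :
  A \in unitmx -> spd T -> 0 <= rho < 1 ->
  (forall i, normT T (residual A f (x i.+1)) <=
             rho * normT T (residual A f (x i))) ->
  x i @[i --> \oo] --> invmx A *m f.
Proof.
move=> Au Ts /andP[rho0 rho1] contr.
have geom i :
    normT T (residual A f (x i)) <= rho ^+ i * normT T (residual A f (x 0)).
  elim: i => [|i IH]; first by rewrite mul1r.
  by rewrite (le_trans (contr i)) // exprS -mulrA ler_wpM2l.
apply: cvg_mx_coord => i j; rewrite (ord1 j).
have [K K0 Kle] := functional_le_normT (row i (invmx A)) Ts.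
have errE k : (invmx A *m f) i 0 - x k i 0 =
              (row i (invmx A) *m residual A f (x k)) 0 0.
  by rewrite -row_mul /residual mulmxBr mulKmx // !mxE.
apply/subr_cvg0; pose C := K * normT T (residual A f (x 0)).
have bound k : `|x k i 0 - (invmx A *m f) i 0| <= C * rho ^+ k.
  rewrite distrC errE (le_trans (Kle _)) // /C -mulrA (mulrC (normT _ _)).
  by rewrite ler_wpM2l.
have geom0 : C * rho ^+ k @[k --> \oo] --> 0.
  by apply: cvg_geometric; rewrite ger0_norm.
apply: (squeeze_cvgr (f := fun k => - (C * rho ^+ k))
                     (h := fun k => C * rho ^+ k)) => //.
  by apply: nearW => k; rewrite -ler_norml.
by rewrite -oppr0; apply: cvgN.
Qed.

End Iteration.

Theorem corollary2 (R : realType) (n : nat) (A T : 'M[R]_n) (f : 'cV[R]_n)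
    (a b c d beta : R) (x0 : 'cV[R]_n)
    (A_nonsing : A \in unitmx) (A_sym : A \is symmetricmx)
    (A_indef : indefinite A) (T_spd : spd T)
    (TA_spec : spectrum_in (T *m A) a b c d)
    (eq_len : b - a = d - c)
    (leab : a <= b) (b_neg : b < 0) (c_pos : 0 < c) (lecd : c <= d)
    (beta_bc : beta \in `]b, c[) :
  let x := iterate A T f beta x0 in
  let r := fun i : nat => residual A f (x i) in
  [/\ x i @[i --> \oo] --> invmx A *m f,
      forall i : nat, r i != 0 ->
        normT T (r i.+1) / normT T (r i) <= rho_opt a b c d beta
    & beta = c - `|b| ->
      forall i : nat, r i != 0 ->
        normT T (r i.+1) / normT T (r i)
          <= (`|a * d| - `|b * c|) / (`|a * d| + `|b * c|)].
Proof.
move=> x r; move: (beta_bc); rewrite in_itv /= => bbc.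
have m_gt0 := quadratic_min_gt0 b_neg c_pos bbc.
have m_leM : Num.min (b ^+ 2 - beta * b) (c ^+ 2 - beta * c) <=
             Num.max (a ^+ 2 - beta * a) (d ^+ 2 - beta * d).
  by apply: quadratic_min_le_max => //; case/andP: bbc.
have bnd lambda (lev : eigenvalue (T *m A) lambda) :=
  quadratic_bounds leab b_neg c_pos lecd bbc (TA_spec lambda lev).
have rhoE := rho_optE erefl erefl m_gt0 m_leM.
have contr i : normT T (r i.+1) <= rho_opt a b c d beta * normT T (r i).
  by rewrite rhoE; apply: normT_residual_step.
have ratio i : r i != 0 ->
    normT T (r i.+1) / normT T (r i) <= rho_opt a b c d beta.
  by move=> ri; rewrite ler_pdivrMr // normT_gt0.
split=> //; last first.
  by move=> betaE i ri; rewrite -rho_opt_center // -betaE; apply: ratio.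
apply: (cvg_of_normT_residual A_nonsing T_spd _ contr).
have M_gt0 := lt_le_trans m_gt0 m_leM.
rewrite rhoE divr_ge0 ?subr_ge0 // ?ltW ?addr_gt0 //=.
by rewrite ltr_pdivrMr ?addr_gt0 // mul1r ltrD2l gtrN.
Qed.
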